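(* Let $X$ be a càdlàg Feller process on $E$ with infinite lifetime, with infinitesimal generator $A$ with domain $\mathbb{D}_A\subset\mathcal{C}_0(E)$, and suppose that $X$ has the FOED property with function of evolution of distribution $F$. Let $f\in\mathbb{D}_A$. Then $$\mathbb{E}f(X_t)=\mathbb{E}\Big(f(X_0)+Af(X_0)\int_0^te^{\int_0^sF(u,X_0)du}\,ds\Big),\qquad t\ge0.$$
   Context: Setting: $(\Omega,\mathcal{F},\mathbb{P})$ is a complete probability space; $X=(X_t)_{t\ge0}$ takes values in $E$, a locally compact space with countable base (LCCB), and has a non-atomic initial distribution. $\mathcal{C}_0(E)$ is the space of bounded continuous functions on $E$ vanishing at infinity. FOED property: $X$ has the FOED property if there is a Borel measurable $F:\mathbb{R}_+\times E\to\mathbb{R}$ such that for every $y\in E$ the function $u\mapsto F(u,y)$ is locally integrable and $\mathbb{E}f(X_t)=\mathbb{E}\big(f(X_0)e^{\int_0^tF(u,X_0)du}\big)$ for every bounded Borel function $f$ on $E$ and every $t\ge0$. Such an $F$ is called the function of evolution of distribution of $X$. *)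

(* Defs.v *)
From HB Require Import structures.
From mathcomp Require Import all_boot all_order all_algebra.
From mathcomp Require Import all_classical all_reals all_analysis.

Set Implicit Arguments.
Unset Strict Implicit.
Unset Printing Implicit Defensive.

Import Order.TTheory GRing.Theory Num.Theory.
Import numFieldNormedType.Exports.

Local Open Scope classical_set_scope.
Local Open Scope ring_scope.

(* E equipped with its Borel sigma-algebra. *)
Notation borel E := (g_sigma_algebraType (@open E)).

(* Locally compact (Hausdorff) with countable base. *)
Definition lccb (E : ptopologicalType) : Prop :=
  [/\ hausdorff_space E, locally_compact [set: E] & @second_countable E].

Definition non_atomic d (T : measurableType d) (R : realType)
    (mu : set T -> \bar R) : Prop :=
  forall A, measurable A -> (0 < mu A)%E ->
    exists B, [/\ measurable B, B `<=` A & (0 < mu B < mu A)%E].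

Section FellerSemigroup.
Variables (R : realType) (E : ptopologicalType).

Definition C0 : set (E -> R) :=
  [set f | [/\ continuous f, bounded_fun f &
     forall e : R, 0 < e ->
       exists2 K : set E, compact K & forall x, ~ K x -> `|f x| < e]].

(* Only the operators T t with 0 <= t, and only their values on C0, are
   constrained.  The bound in fs_contr ranges over all upper bounds M of |f|,
   i.e. it says that the sup norm of T t f is at most that of f.  T is not
   required to be conservative. *)
Record feller_semigroup (T : R -> (E -> R) -> (E -> R)) : Prop := {
  fs_C0 : forall t f, 0 <= t -> C0 f -> C0 (T t f) ;
  fs_linear : forall t (a : R) f g, 0 <= t -> C0 f -> C0 g ->
    T t (fun x => a * f x + g x) = (fun x => a * T t f x + T t g x) ;
  fs_pos : forall t f, 0 <= t -> C0 f ->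
    (forall x, 0 <= f x) -> forall x, 0 <= T t f x ;
  fs_contr : forall t f (M : R), 0 <= t -> C0 f ->
    (forall x, `|f x| <= M) -> forall x, `|T t f x| <= M ;
  fs_id : forall f, C0 f -> T 0 f = f ;
  fs_add : forall s t f, 0 <= s -> 0 <= t -> C0 f ->
    T (s + t) f = T s (T t f) ;
  fs_cont : forall f, C0 f -> {uniform, T t f @[t --> 0^'+] --> f}
}.

(* g is the limit in C0 (for the sup norm) of (T t f - f) / t as t tends to 0
   from the right. *)
Definition generator_limit (T : R -> (E -> R) -> (E -> R)) (f g : E -> R) :
    Prop :=
  C0 g /\
  {uniform, (fun x : E => (T t f x - f x) / t) @[t --> 0^'+] --> g}.

Definition generator_domain (T : R -> (E -> R) -> (E -> R)) : set (E -> R) :=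
  [set f | C0 f /\ exists g, generator_limit T f g].

(* Junk value 0 outside of generator_domain T. *)
Definition generator (T : R -> (E -> R) -> (E -> R)) (f : E -> R) : E -> R :=
  xget (fun=> 0) [set g | generator_limit T f g].

End FellerSemigroup.

(* Processes are indexed by the whole of R, but only the variables X t with
   0 <= t are ever constrained or used. *)
Section Processes.
Variables (R : realType) (d : measure_display) (Omega : measurableType d).
Variables (P : probability Omega R) (E : ptopologicalType).

Definition cadlag (X : R -> Omega -> E) : Prop :=
  forall w,
    (forall t, 0 <= t -> X s w @[s --> t^'+] --> X t w) /\
    (forall t, 0 < t -> exists l : E, X s w @[s --> t^'-] --> l).

(* sigma(X_u, 0 <= u <= s). *)
Definition natural_filtration (X : R -> Omega -> E) (s : R) :
    set (set Omega) :=
  <<s [set A | exists u, exists B : set (borel E),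
         [/\ 0 <= u <= s, measurable B & A = X u @^-1` B]] >>.

(* The last clause is the Markov property
   E(g(X_(s+t)) | sigma(X_u, u <= s)) = (T t g)(X_s) a.s. for g in C0, with the
   conditional expectation given by its defining property: the right-hand side
   is sigma(X_s)-measurable since T t g is continuous.
   An infinite lifetime means that the process never visits the cemetery point
   adjoined to E; it is rendered by the state space of X being E itself. *)
Definition feller_process (T : R -> (E -> R) -> (E -> R))
    (X : R -> Omega -> E) : Prop :=
  [/\ feller_semigroup T,
      forall t, 0 <= t -> measurable_fun setT (X t : Omega -> borel E) &
      forall s t g B, 0 <= s -> 0 <= t -> C0 g -> natural_filtration X s B ->
        (\int[P]_(w in B) (g (X (s + t) w))%:E =
         \int[P]_(w in B) (T t g (X s w))%:E)%E].

(* F witnesses the FOED property of X, as its function of evolution of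
   distribution.  Local integrability on R_+ amounts to integrability on each [0, t]; the
   library's locally_integrable only covers open domains.  The equality holds
   in \bar R with a finite left-hand side, so it entails the integrability of
   the random variable on the right (the integral of a non-integrable function
   is infinite in the library). *)
Definition evolution_function (X : R -> Omega -> E) (F : R -> E -> R) : Prop :=
  [/\ measurable_fun
        [set z : measurableTypeR R * borel E | 0 <= z.1]
        (fun z : measurableTypeR R * borel E => F z.1 z.2),
      forall (y : E) (t : R), 0 <= t ->
        (@lebesgue_measure R).-integrable `[0, t] (fun u => (F u y)%:E) &
      forall (f : E -> R) (t : R), measurable_fun setT (f : borel E -> R) -> bounded_fun f ->
        0 <= t ->
        ('E_P[fun w => f (X t w)] =
         'E_P[fun w => (f (X 0 w) *
           expR (\int[@lebesgue_measure R]_(u in `[0, t]) F u (X 0 w)))%R])%E].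

End Processes.

(* Main.v *)
Require Import Defs.
From mathcomp Require Import all_boot all_order all_algebra.
From mathcomp Require Import all_classical all_reals all_analysis.
From mathcomp Require Import measurable_realfun ring lra.

(** Let [g] be the generator of [f]. By the Markov property
    [E f(X_(s+h)) - E f(X_s) - h E g(X_s) = E (T_h f - f - h g)(X_s)], which is
    [o(h)] uniformly in [s], and [s |-> E g(X_s)] is continuous; hence Dynkin's
    formula [E f(X_t) = E f(X_0) + \int_0^t E g(X_s) ds]. The FOED property
    rewrites [E g(X_s)] as [E (g(X_0) exp(\int_0^s F(u, X_0) du))], and, applied
    to the constant 1, shows that the exponential weight has mean 1, so that
    Fubini's theorem applies to the time integral. *)

Set Implicit Arguments.
Unset Strict Implicit.
Unset Printing Implicit Defensive.

Import Order.TTheory GRing.Theory Num.Theory.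
Import numFieldNormedType.Exports.
Local Open Scope classical_set_scope.
Local Open Scope ring_scope.

(** * Calculus: from uniform right-hand expansions to the fundamental theorem *)

Lemma uniform_near (U : choiceType) (R : realType) (G : set_system (U -> R))
    (f : U -> R) (e : R) :
  Filter G -> {uniform, G --> f} -> 0 < e ->
  \forall g \near G, forall x, `|g x - f x| < e.
Proof.
move=> FG Gf e0.
apply: Gf; apply/uniform_nbhs.
exists [set xy : R * R | ball xy.1 e xy.2]; split.
  by rewrite -entourage_from_ballE; exists e.
by move=> g /= fg x; rewrite distrC; exact: fg.
Qed.

(** Uniformity in the base point makes the right-hand estimates two-sided: a step back from [s] is a
    step forward from [s + h] with [h < 0]. Hence [phi] is differentiable on the open half-line with
    continuous derivative [psi]. *)
Lemma right_derivable_FTC (R : realType) (phi psi : R -> R) (t : R) :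
  (forall e : R, 0 < e -> \forall h \near 0^'+, forall s : R, 0 <= s ->
     `|phi (s + h) - phi s - h * psi s| <= e * h) ->
  (forall e : R, 0 < e -> \forall h \near 0^'+, forall s : R, 0 <= s ->
     `|psi (s + h) - psi s| <= e) ->
  0 < t ->
  (\int[@lebesgue_measure R]_(s in `[0%R, t]) (psi s)%:E =
   (phi t)%:E - (phi 0%R)%:E)%E.
Proof.
move=> dphi cpsi t0.
have psi_near (e : R) : 0 < e -> exists2 d : R, 0 < d & forall s r : R, 0 <= s -> 0 <= r ->
    `|s - r| < d -> `|psi s - psi r| <= e.
  move=> e0; have [d /= d0 dP] := cpsi _ e0.
  exists d => // s r; wlog rs : s r / r <= s => [hw s0 r0 sr|s0 r0 sr].
    have [rs|/ltW rs] := leP r s; first exact: hw.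
    by rewrite distrC; apply: hw => //; rewrite distrC.
  move: rs; rewrite le_eqVlt => /predU1P[->|rs]; first by rewrite subrr normr0 ltW.
  have := dP (s - r); rewrite /ball_ /= sub0r normrN => /(_ sr).
  by rewrite subr_gt0 => /(_ rs r r0); rewrite subrKC.
(* For [h < 0], expand forward from [s + h] with step [- h], then replace [psi (s + h)] by [psi s];
   each of the two errors costs [e / 2]. *)
have phi_near (e : R) : 0 < e -> exists2 d : R, 0 < d & forall s h : R, 0 <= s -> 0 <= s + h ->
    `|h| < d -> `|phi (s + h) - phi s - h * psi s| <= e * `|h|.
  move=> e0.
  have e20 : 0 < e / 2 by rewrite divr_gt0.
  have [d1 d10 d1P] := psi_near _ e20.
  have [d2 /= d20 d2P] := dphi _ e20.
  exists (Num.min d1 d2); first by rewrite lt_min d10.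
  move=> s h s0 sh0; rewrite lt_min => /andP[hd1 hd2].
  have [h0|h0|->] := ltrgtP h 0; last first.
  - by rewrite addr0 mul0r !subrr normr0 mulr0.
  - have := d2P h; rewrite /ball_ /= sub0r normrN => /(_ hd2 h0 _ s0) /le_trans; apply.
    by rewrite (gtr0_norm h0) ler_pM2r// ler_pdivrMr// ler_pMr// ler1n.
  have Nh0 : 0 < - h by rewrite oppr_gt0.
  have := d2P (- h); rewrite /ball_ /= sub0r !normrN => /(_ hd2 Nh0 _ sh0).
  rewrite addrK => H.
  have := d1P _ _ s0 sh0; rewrite opprD addrA subrr sub0r normrN => /(_ hd1) H'.
  rewrite (ltr0_norm h0).
  have -> : phi (s + h) - phi s - h * psi s =
      - (phi s - phi (s + h) - (- h) * psi (s + h)) +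
      (- h) * (psi s - psi (s + h)) by ring.
  rewrite (le_trans (ler_normD _ _))// normrN normrM normrN (ltr0_norm h0).
  rewrite [e]splitr mulrDl lerD// mulrC ler_wpM2r// ltW//.
have dphi' (s : R) : 0 < s ->
    (fun h => h^-1 *: ((phi \o shift s) (h *: 1) - phi s)) @ 0^' --> psi s.
  move=> s0; apply/cvgrPdist_le => /= e e0.
  have [d d0 dP] := phi_near _ e0.
  (* Bounding [|h|] by [s] as well keeps [s + h] nonnegative, as [phi_near] requires. *)
  exists (Num.min d s); first by rewrite /= lt_min d0.
  move=> h; rewrite /ball_ /= sub0r normrN lt_min => /andP[hd hs] h0.
  have sh0 : 0 <= s + h by have := ler_norm (- h); rewrite normrN; lra.
  have := dP _ _ (ltW s0) sh0 hd.
  have -> : phi (s + h) - phi s - h * psi s =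
      (- h) * (psi s - h^-1 *: (phi (h *: 1 + s) - phi s)).
    by rewrite /GRing.scale /= mulr1 addrC [h + s]addrC; field.
  by rewrite normrM normrN mulrC ler_pM2r// normr_gt0.
have dphiE (s : R) : 0 < s -> is_derive s 1 phi (psi s).
  move=> s0; apply: DeriveDef; first by apply/cvg_ex; exists (psi s); exact: dphi'.
  by apply: (cvg_lim _ (dphi' _ s0)); exact: norm_hausdorff.
apply: continuous_FTC2 => //.
- apply/subspace_continuousP => s /=; rewrite in_itv /= => /andP[s0 _].
  apply/cvgrPdist_le => /= e e0.
  have [d d0 dP] := psi_near _ e0.
  exists d => // r /= sr; rewrite in_itv /= => /andP[r0 _].
  exact: dP.
- split.
  + by move=> s; rewrite in_itv /= => /andP[s0 _]; case: (dphiE _ s0).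
  + apply/cvgrPdist_le => /= e e0.
    (* Right continuity of [phi] at 0: the expansion at 0 with error constant 1 gives
       [|phi h - phi 0| <= h * (|psi 0| + 1)], hence the radius below. *)
    have [d d0 dP] := phi_near _ ltr01.
    have k0 : 0 < `|psi 0| + 1 by rewrite ltr_wpDl.
    exists (Num.min d (e / (`|psi 0| + 1))); first by rewrite /= lt_min d0 divr_gt0.
    move=> h; rewrite /ball_ /= sub0r normrN lt_min => /andP[hd he] h0.
    have := dP 0 h (lexx _); rewrite add0r => /(_ (ltW h0) hd); rewrite mul1r => H.
    have -> : phi 0 - phi h = - (phi h - phi 0 - h * psi 0 + h * psi 0) by ring.
    rewrite normrN (le_trans (ler_normD _ _))// normrM.
    move: he; rewrite ltr_pdivlMr//; lra.
  + apply: cvg_at_left_filter; apply: differentiable_continuous.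
    by apply/derivable1_diffP; case: (dphiE _ t0).
- move=> s; rewrite in_itv /= => /andP[s0 _].
  by rewrite derive1E; case: (dphiE _ s0).
Qed.

(** * Measurability and Fubini for integrals over a time interval *)

Lemma measurable_parametric_Rintegral (R : realType) (d : measure_display)
    (T : measurableType d) (G : R -> T -> R) (b : T -> R) :
  measurable_fun [set z : measurableTypeR R * T | 0 <= z.1]
    (fun z : measurableTypeR R * T => G z.1 z.2) ->
  measurable_fun setT b ->
  measurable_fun setT
    (fun z => \int[@lebesgue_measure R]_(u in `[0, b z]) G u z).
Proof.
move=> mG mb.
(* The domain depending on [z] is absorbed into a restriction to the region [D]. Tonelli then gives
   measurability for the positive and negative parts separately, and the real integral is [fine] of
   their difference. *)
pose D := [set q : T * measurableTypeR R | 0 <= q.2 <= b q.1].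
pose H := (fun q : T * measurableTypeR R => (G q.2 q.1)%:E) \_ D.
have mD : measurable D.
  rewrite [D](_ : _ = (setT `&` [set q | 0 <= q.2]) `&`
      (setT `&` [set q | q.2 <= b q.1])).
    apply: measurableI; apply: measurable_fun_le => //=.
    exact: (measurableT_comp mb measurable_fst).
  by rewrite !setTI; apply/seteqP; split=> q /=; [move/andP|move=> ?; apply/andP].
have mH : measurable_fun [set: T * measurableTypeR R] H.
  apply/(measurable_restrictT _ mD).
  apply/measurable_EFinP.
  have m0 : measurable [set z : measurableTypeR R * T | 0 <= z.1].
    by rewrite -[X in measurable X]setTI; apply: measurable_fun_le.
  have swapD : (fun q : T * measurableTypeR R => (q.2, q.1)) @` D `<=`
      [set z : measurableTypeR R * T | 0 <= z.1] by move=> _ [q /andP[? ?] <-].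
  apply: (measurable_comp m0 swapD mG).
  by apply: measurable_funTS; apply: measurable_fun_pair.
rewrite [X in measurable_fun _ X](_ : _ = fine \o (fun z =>
    \int[@lebesgue_measure R]_u H^\+ (z, u) -
    \int[@lebesgue_measure R]_u H^\- (z, u))%E).
  apply: measurableT_comp => //; apply: emeasurable_funB.
    by apply: measurable_fun_fubini_tonelli_F => //; exact: measurable_funepos.
  by apply: measurable_fun_fubini_tonelli_F => //; exact: measurable_funeneg.
apply/funext => z; congr fine.
rewrite integral_mkcond [LHS](_ : _ = \int[@lebesgue_measure R]_u H (z, u))%E.
  rewrite integralE; congr (_ - _)%E; apply: eq_integral => u _.
    by rewrite funepos_comp.
  by rewrite funeneg_comp.
by apply: eq_integral => u _; rewrite /H !patchE; congr (if _ then _ else _).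
Qed.

(** Since [|g| <= M] and [Z w s] has mean at most [C], the absolute double integral is at most
    [M * C] times the length of [[0, t]], so Fubini applies. *)
Lemma Fubini_weighted (R : realType) (d : measure_display)
    (Omega : measurableType d) (P : probability Omega R)
    (Z : Omega -> R -> R) (g : Omega -> R) (t M C : R) :
  measurable_fun [set: Omega * measurableTypeR R] (fun z => Z z.1 z.2) ->
  (forall w s, 0 <= Z w s) ->
  (forall w, (@lebesgue_measure R).-integrable `[0, t] (fun s => (Z w s)%:E)) ->
  (forall s, 0 <= s -> (\int[P]_w (Z w s)%:E <= C%:E)%E) ->
  0 <= M -> measurable_fun setT g -> (forall w, `|g w| <= M) ->
  P.-integrable setT
    (fun w => (g w * \int[@lebesgue_measure R]_(s in `[0, t]) Z w s)%:E) /\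
  (\int[P]_w (g w * \int[@lebesgue_measure R]_(s in `[0, t]) Z w s)%:E =
   \int[@lebesgue_measure R]_(s in `[0%R, t]) \int[P]_w (g w * Z w s)%:E)%E.
Proof.
move=> mZ Z0 iZ ZC M0 mg gM.
pose D := [set q : Omega * measurableTypeR R | q.2 \in `[0, t]].
pose H := (fun q : Omega * measurableTypeR R => (g q.1 * Z q.1 q.2)%:E) \_ D : _ -> \bar R.
have mD : measurable D.
  rewrite [D](_ : _ = setT `*` `[0, t]); first exact: measurableX.
  by apply/seteqP; split => q //= [].
have mH : measurable_fun [set: Omega * measurableTypeR R] H.
  apply/(measurable_restrictT _ mD).
  apply/measurable_EFinP/measurable_funTS.
  apply: measurable_funM => //.
  exact: measurableT_comp mg measurable_fst.
have mZs s : measurable_fun setT (fun w => (Z w s)%:E).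
  apply/measurable_EFinP.
  exact: (measurableT_comp mZ (measurable_pair2 s)).
have HE0 w s : H (w, s) = if s \in `[0, t] then (g w * Z w s)%:E else 0%E.
  by rewrite /H patchE; congr (if _ then _ else _); apply/idP/idP; rewrite !inE.
(* Integrability of [Z w] in time makes its integral finite, so the real-valued integral agrees with
   the extended one and [g w] can be moved inside. *)
have HE w : (\int[@lebesgue_measure R]_s H (w, s) =
    (g w * \int[@lebesgue_measure R]_(s in `[0, t]) Z w s)%:E)%E.
  rewrite EFinM fineK; last exact: integrable_fin_num.
  rewrite -integralZl// [RHS]integral_mkcond.
  by apply: eq_integral => s _; rewrite /H !patchE.
have iH : (P \x @lebesgue_measure R)%E.-integrable setT H.
  (* Integrability is tested by integrating over [Omega] first, because the bound [C] holds for each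
     fixed time. *)
  apply/integrable21ltyP => //.
  apply: (@le_lt_trans _ _ (\int[@lebesgue_measure R]_(s in `[0%R, t]) (M * C)%:E)%E).
    rewrite [leRHS]integral_mkcond; apply: ge0_le_integral => //.
    - by move=> s _; apply: integral_ge0.
    - apply: (measurable_fun_fubini_tonelli_G (abse \o H)) => //=.
      exact: measurableT_comp.
    - apply/(measurable_restrictT _ (measurable_itv _)); exact: measurable_cst.
    - move=> s _; rewrite patchE mem_setE; case: ifPn => st; last first.
        rewrite integral0_eq// => w _.
        by rewrite HE0 (negbTE st) abse0.
      apply: (@le_trans _ _ (\int[P]_w (M%:E * (Z w s)%:E))%E).
        apply: ge0_le_integral => //.
        + apply: measurableT_comp => //.
          exact: (measurableT_comp mH (measurable_pair2 s)).
        + exact: measurable_funeM.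
        + move=> w _; rewrite HE0 st -EFinM lee_fin normrM.
          by rewrite (ger0_norm (Z0 _ _)) ler_wpM2r.
      rewrite ge0_integralZl// ?lee_fin//; last first.
        by move=> w _; rewrite lee_fin.
      rewrite EFinM lee_wpmul2l ?lee_fin// ZC//.
      by move: st; rewrite in_itv /= => /andP[].
  by rewrite integral_cst//= lebesgue_measure_itv/= lte_fin; case: ifPn => _;
    rewrite -?EFinD -?EFinM ltry.
split.
  by under eq_fun do rewrite -HE; exact: integrable_fubini_F iH.
under eq_integral do rewrite -HE.
rewrite (Fubini iH) [RHS]integral_mkcond; apply: eq_integral => s _.
rewrite patchE mem_setE; case: ifPn => st.
  by apply: eq_integral => w _; rewrite HE0 st.
by rewrite integral0_eq// => w _; rewrite HE0 (negbTE st).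
Qed.

(** * Preliminaries on [C0], the generator and bounded random variables *)

Lemma continuous_borel_measurable (R : realType) (E : ptopologicalType)
    (f : E -> R) :
  continuous f -> measurable_fun setT (f : borel E -> R).
Proof.
move=> /continuousP cf; apply: (measurability _ (RGenOpens.measurableE R)).
move=> _ [_ [a [b ->] <-]]; rewrite setTI; apply: sub_sigma_algebra.
exact/cf/interval_open.
Qed.

Lemma C0_bounded (R : realType) (E : ptopologicalType) (f : E -> R) :
  C0 f -> exists2 M, 0 <= M & forall x, `|f x| <= M.
Proof.
case=> _ [M [_ bM]] _; exists (`|M| + 1); first by rewrite addr_ge0.
move=> x; apply: (bM (`|M| + 1)) => //.
by rewrite (le_lt_trans (ler_norm M))// ltrDl.
Qed.

Lemma generatorP (R : realType) (E : ptopologicalType)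
    (T : R -> (E -> R) -> (E -> R)) (f : E -> R) :
  generator_domain T f -> generator_limit T f (generator T f).
Proof.
by move=> [_ [g Tfg]]; rewrite /generator; case: xgetP => [h -> //|/(_ g)]; exact.
Qed.

(** Lets the Markov property be used on the whole space, where it becomes an identity between
    expectations. *)
Lemma natural_filtration_setT (R : realType) (d : measure_display)
    (Omega : measurableType d) (E : ptopologicalType) (X : R -> Omega -> E)
    (s : R) :
  0 <= s -> natural_filtration X s setT.
Proof.
move=> s0; apply: sub_sigma_algebra; exists 0, setT.
by rewrite lexx s0 preimage_setT; split.
Qed.

Lemma bounded_integrable (R : realType) (d : measure_display)
    (Omega : measurableType d) (P : probability Omega R) (Y : Omega -> R) (M : R) :
  measurable_fun setT Y -> (forall w, `|Y w| <= M) ->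
  P.-integrable setT (fun w => (Y w)%:E).
Proof.
move=> mY YM; apply: measurable_bounded_integrable => //.
  by rewrite -ge0_fin_numE ?fin_num_measure.
exists M; split; first exact: num_real.
by move=> N MN w _ /=; rewrite (le_trans (YM w))// ltW.
Qed.

Lemma normr_Rintegral_le (R : realType) (d : measure_display)
    (Omega : measurableType d) (P : probability Omega R) (Y : Omega -> R) (M : R) :
  measurable_fun setT Y -> (forall w, `|Y w| <= M) -> `|\int[P]_w Y w| <= M.
Proof.
move=> mY YM; have iY := bounded_integrable P mY YM.
rewrite (le_trans (le_normr_Rintegral _ _))//.
rewrite [leRHS](_ : M = \int[P]_w M); last first.
  rewrite Rintegral_cst// (_ : fine _ = 1) ?mulr1//.
  exact: (congr1 fine (probability_setT P)).
apply: le_Rintegral => //.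
- by have := integrable_norm iY.
- exact: finite_measure_integrable_cst.
Qed.

(** * Dynkin's formula for the expectations of a Feller process *)

Section feller_mean.
Context (R : realType) (d : measure_display) (Omega : measurableType d).
Context (P : probability Omega R) (E : ptopologicalType).
Variables (T : R -> (E -> R) -> (E -> R)) (X : R -> Omega -> E).
Hypothesis X_feller : feller_process P T X.

Let mean (h : E -> R) (s : R) := \int[P]_w h (X s w).

Lemma C0_measurable_comp (h : E -> R) (s : R) :
  C0 h -> 0 <= s -> measurable_fun setT (fun w => h (X s w)).
Proof.
move=> [ch _ _] s0; have [_ mX _] := X_feller.
exact: measurableT_comp (continuous_borel_measurable ch) (mX s s0).
Qed.

Lemma C0_integrable_comp (h : E -> R) (s : R) :
  C0 h -> 0 <= s -> P.-integrable setT (fun w => (h (X s w))%:E).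
Proof.
move=> C0h s0; have [M _ hM] := C0_bounded C0h.
exact: bounded_integrable (C0_measurable_comp C0h s0) (fun w => hM _).
Qed.

Lemma mean_shift (h : E -> R) (s u : R) : C0 h -> 0 <= s -> 0 <= u ->
  mean h (s + u) = mean (T u h) s.
Proof.
move=> C0h s0 u0; have [_ _ markov] := X_feller.
by rewrite /mean /Rintegral markov//; exact: natural_filtration_setT.
Qed.

(** By [mean_shift] the increment is the expectation of [T u h - h] at [X s]. It is bounded by the
    sup norm, which is small by strong continuity and does not depend on [s]. *)
Lemma mean_cont (h : E -> R) (e : R) : C0 h -> 0 < e ->
  \forall u \near 0^'+, forall s : R, 0 <= s -> `|mean h (s + u) - mean h s| <= e.
Proof.
move=> C0h e0; have [[TC0 _ _ _ _ _ Tcont] _ _] := X_feller.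
have Th : \forall u \near 0^'+, forall x, `|T u h x - h x| < e :=
  uniform_near _ (Tcont h C0h) e0.
near=> u => s s0.
have u0 : 0 <= u by [].
have iTh := C0_integrable_comp (TC0 _ _ u0 C0h) s0.
have ih := C0_integrable_comp C0h s0.
rewrite mean_shift// /mean -RintegralB//.
apply: normr_Rintegral_le.
  by apply: measurable_funB; apply: C0_measurable_comp => //; exact: TC0.
move=> w; apply/ltW; move: (X s w); near: u; exact: Th.
Unshelve. all: by end_near. Qed.

Lemma mean_right_derivable (f g : E -> R) (e : R) : C0 f -> generator_limit T f g -> 0 < e ->
  \forall u \near 0^'+, forall s : R, 0 <= s ->
    `|mean f (s + u) - mean f s - u * mean g s| <= e * u.
Proof.
move=> C0f [C0g gen] e0; have [[TC0 _ _ _ _ _ _] _ _] := X_feller.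
have Tf : \forall u \near 0^'+, forall x, `|(T u f x - f x) / u - g x| < e :=
  uniform_near _ gen e0.
near=> u => s s0.
have u0 : 0 < u by [].
have iTf := C0_integrable_comp (TC0 _ _ (ltW u0) C0f) s0.
have iF := C0_integrable_comp C0f s0.
have iG := C0_integrable_comp C0g s0.
rewrite (mean_shift C0f s0 (ltW u0)) /mean -RintegralB// -RintegralZl// -RintegralB//; last 2 first.
- have := integrableB measurableT iTf iF; apply: eq_integrable => //.
- have := integrableZl measurableT u iG; apply: eq_integrable => //.
apply: normr_Rintegral_le.
  apply: measurable_funB; last by apply: measurable_funM => //; exact: C0_measurable_comp.
  by apply: measurable_funB; apply: C0_measurable_comp => //; apply: TC0 => //; exact: ltW.
move=> w.
(* Factoring out [u] exposes the difference quotient, which is within [e] of [g] uniformly on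
   [E]. *)
have -> : T u f (X s w) - f (X s w) - u * g (X s w) =
   ((T u f (X s w) - f (X s w)) / u - g (X s w)) * u by field; rewrite gt_eqF.
rewrite normrM (gtr0_norm u0) ler_pM2r//.
apply/ltW; move: (X s w); near: u; exact: Tf.
Unshelve. all: by end_near. Qed.

(** The two preceding estimates are the hypotheses of [right_derivable_FTC] for [mean f] and
    [mean g]. *)
Lemma dynkin_formula (f g : E -> R) (t : R) : C0 f -> generator_limit T f g -> 0 < t ->
  (\int[@lebesgue_measure R]_(s in `[0%R, t]) \int[P]_w (g (X s w))%:E =
   \int[P]_w (f (X t w))%:E - \int[P]_w (f (X 0%R w))%:E)%E.
Proof.
move=> C0f Tfg t0; have C0g := Tfg.1.
have meanE (h : E -> R) (s : R) : C0 h -> 0 <= s -> (\int[P]_w (h (X s w))%:E)%E = (mean h s)%:E.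
  by move=> C0h s0; rewrite fineK//; apply: integrable_fin_num => //; exact: C0_integrable_comp.
rewrite !meanE// ?ltW// -(right_derivable_FTC (psi := mean g))//.
- by apply: eq_integral => s; rewrite inE /= in_itv /= => /andP[s0 _]; exact: meanE.
- by move=> e e0; exact: mean_right_derivable.
- by move=> e e0; exact: mean_cont.
Qed.

End feller_mean.

(** * The exponential weight of the FOED property *)

Section evolution_density.
Context (R : realType) (d : measure_display) (Omega : measurableType d).
Context (P : probability Omega R) (E : ptopologicalType).
Variables (X : R -> Omega -> E) (F : R -> E -> R).
Hypothesis mX0 : measurable_fun setT (X 0 : Omega -> borel E).
Hypothesis X_foed : evolution_function P X F.

(** The weight on the initial state that produces the distribution of [X s]. *)
Let Z (w : Omega) (s : R) :=
  expR (\int[@lebesgue_measure R]_(u in `[0, s]) F u (X 0 w)).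

Lemma measurable_evolution_density :
  measurable_fun [set: Omega * measurableTypeR R] (fun z => Z z.1 z.2).
Proof.
have [mF _ _] := X_foed.
apply: (measurableT_comp (@measurable_expR R)).
(* The parameter is the pair of outcome and time, and [snd] is the upper limit; this gives joint
   measurability. *)
apply: (@measurable_parametric_Rintegral _ _ (Omega * measurableTypeR R)%type
  (fun u z => F u (X 0 z.1)) snd); last exact: measurable_snd.
have m0 : measurable [set z : measurableTypeR R * borel E | 0 <= z.1].
  by rewrite -[X in measurable X]setTI; apply: measurable_fun_le.
pose h (z : measurableTypeR R * (Omega * measurableTypeR R)) :
  measurableTypeR R * borel E := (z.1, X 0 z.2.1).
have hD : h @` [set z | 0 <= z.1] `<=` [set z | 0 <= z.1] by move=> _ [z ? <-].
apply: (measurable_comp m0 hD mF).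
apply: measurable_funTS; apply: measurable_fun_pair => //.
apply: (measurableT_comp mX0).
exact: (measurableT_comp measurable_fst measurable_snd).
Qed.

(** Local integrability of [F] makes its integral continuous in the upper limit, so each path of [Z]
    is continuous on the compact interval [[0, t]]. *)
Lemma integrable_evolution_density w (t : R) : 0 <= t ->
  (@lebesgue_measure R).-integrable `[0, t] (fun s => (Z w s)%:E).
Proof.
move=> t0; have [_ iF _] := X_foed.
have := parameterized_integral_continuous t0 (iF (X 0 w) t t0).
move=> cF; apply: continuous_compact_integrable; first exact: segment_compact.
move=> s; apply: continuous_comp (cF s) _; exact: continuous_expR.
Qed.

Lemma integral_evolution_density (s : R) : 0 <= s ->
  (\int[P]_w (Z w s)%:E = 1)%E.
Proof.
move=> s0; have [_ _ foed] := X_foed.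
have b1 : bounded_fun (cst 1 : E -> R).
  by exists 1; split; [exact: num_real|move=> N /ltW N1 x _; rewrite /= normr1].
have := foed _ s (@measurable_cst _ _ (borel E) R setT 1) b1 s0.
rewrite expectation_cst unlock => ->.
by apply: eq_integral => w _; rewrite mul1r.
Qed.

End evolution_density.

Unset Implicit Arguments.

Theorem proposition3p1 (R : realType) (d : measure_display)
    (Omega : measurableType d) (P : probability Omega R)
    (P_complete : measure_is_complete P)
    (E : ptopologicalType) (E_lccb : lccb E)
    (X : R -> Omega -> E)
    (X0_non_atomic :
       non_atomic (pushforward P (X 0 : Omega -> borel E)))
    (T : R -> (E -> R) -> (E -> R))
    (X_feller : feller_process P T X) (X_cadlag : cadlag X)
    (F : R -> E -> R) (X_foed : evolution_function P X F)
    (f : E -> R) (f_dom : generator_domain T f)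
    (t : R) (t_ge0 : 0 <= t) :
  ('E_P[fun w => f (X t w)] =
   'E_P[fun w => (f (X 0 w) + generator T f (X 0 w) *
     \int[@lebesgue_measure R]_(s in `[0, t])
       expR (\int[@lebesgue_measure R]_(u in `[0, s]) F u (X 0 w)))%R])%E.
Proof.
have [C0f _] := f_dom; have Tfg := generatorP f_dom.
move: (generator T f) Tfg => g Tfg; have C0g := Tfg.1.
(* At [t = 0] the time integral is over a single point and vanishes; Dynkin's formula is available
   for [0 < t]. *)
rewrite unlock; move: t_ge0; rewrite le_eqVlt => /predU1P[<-|t0].
  by apply: eq_integral => w _; rewrite set_itv1 Rintegral_set1 mulr0 addr0.
have t_ge0 := ltW t0.
have [_ mX _] := X_feller; have mX0 := mX 0 (lexx 0).
have [_ _ foed] := X_foed.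
have [M M0 gM] := C0_bounded C0g.
have Z1 s : 0 <= s -> (\int[P]_w (expR
    (\int[@lebesgue_measure R]_(u in `[0%R, s]) F u (X 0%R w)))%:E <= 1%:E)%E.
  by move=> s0; rewrite (integral_evolution_density X_foed s0).
(* The constant [C = 1] is the mean of the exponential weight at every time. *)
have [iG EG] := Fubini_weighted (C := 1) (measurable_evolution_density mX0 X_foed)
  (fun w s => expR_ge0 _)
  (fun w => integrable_evolution_density X_foed w t_ge0)
  Z1
  M0 (C0_measurable_comp X_feller C0g (lexx 0)) (fun w => gM (X 0 w)).
rewrite integralD_EFin//; last exact: (C0_integrable_comp X_feller C0f).
(* Subtract and add back the finite quantity [E f(X_0)], so that Dynkin's formula can replace the
   increment of the expectation. *)
rewrite EG -(@subeK _ (\int[P]_w (f (X t w))%:E) (\int[P]_w (f (X 0%R w))%:E))%E; last first.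
  by apply: integrable_fin_num => //; exact: (C0_integrable_comp X_feller C0f).
rewrite addeC -(dynkin_formula X_feller C0f Tfg t0); congr (_ + _)%E.
(* The two time integrals have the same integrand: this is the FOED property applied to [g] at time
   [s]. *)
apply: eq_integral => s; rewrite inE /= in_itv /= => /andP[s0 _].
have [cg _ _] := C0g.
have := foed g s (continuous_borel_measurable cg).
rewrite unlock; apply => //.
by exists M; split; [exact: num_real|move=> N MN x _ /=; rewrite (le_trans (gM x))// ltW].
Qed.
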